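(* Let $\mathbf{A}$ be a nonempty subset of $\mathbf{P}_{\mathbf{PU}}$. Then the following statements are equivalent. (i) $\mathbf{A}$ is a submonoid of $(\mathbf{P}_{\mathbf{PU}}, \circ)$. (ii) $\mathbf{A}$ is a submonoid of $(\mathbf{End}_{\mathbb{R}^+}, \circ)$. (iii) There is a nonempty subclass $\mathbf{X} \subseteq \mathbf{PU}$ that satisfies $\mathbf{P}_{\mathbf{X}} = \mathbf{A}$.
   Context: $\mathbb{R}^+ = [0,\infty)$. A pseudoultrametric on a nonempty set $X$ is a function $d : X \times X \to \mathbb{R}^+$ such that $d(x,x)=0$, $d(x,y)=d(y,x)$ and $d(x,y) \leqslant \max\{d(x,z), d(z,y)\}$ for all $x,y,z \in X$; then $(X,d)$ is a pseudoultrametric space. $\mathbf{PU}$ denotes the class of all pseudoultrametric spaces. A function $f : \mathbb{R}^+ \to \mathbb{R}^+$ is pseudoultrametric-preserving if $f \circ d$ (the mapping $(x,y) \mapsto f(d(x,y))$) is a pseudoultrametric on $X$ for every pseudoultrametric space $(X,d)$; $\mathbf{P}_{\mathbf{PU}}$ is the set of all pseudoultrametric-preserving functions. For a subclass $\mathbf{X}$ of $\mathbf{PU}$, $\mathbf{P}_{\mathbf{X}}$ is the set of all functions $f : \mathbb{R}^+ \to \mathbb{R}^+$ such that $(Y, f \circ \rho) \in \mathbf{X}$ whenever $(Y,\rho) \in \mathbf{X}$. $\mathbf{End}_{\mathbb{R}^+}$ is the set of all endomorphisms of the monoid $(\mathbb{R}^+, \vee)$, where $x \vee y = \max\{x,y\}$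 and the identity element is $0$; that is, of all $f : \mathbb{R}^+ \to \mathbb{R}^+$ with $f(x \vee y) = f(x) \vee f(y)$ for all $x,y$ and $f(0)=0$. Both $\mathbf{End}_{\mathbb{R}^+}$ and $\mathbf{P}_{\mathbf{PU}}$ are monoids under function composition $\circ$, with identity the identical mapping $\mathrm{Id}_{\mathbb{R}^+}$. A submonoid of a monoid is a nonempty subset closed under the operation and containing the identity element of the monoid. *)

(* Defs.v *)
From HB Require Import structures.
From mathcomp Require Import all_boot all_order all_algebra.
From mathcomp Require Import all_classical all_reals interval_inference.

Set Implicit Arguments.
Unset Strict Implicit.
Unset Printing Implicit Defensive.

Import Order.TTheory GRing.Theory Num.Theory.

Local Open Scope classical_set_scope.
Local Open Scope ring_scope.

(* No axiom is imposed on [dist]: this way [postcomp f S] is defined for every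
   [f] and every [S], and being a pseudoultrametric is a property to check. *)
Record distSpace (R : realType) := DistSpace {
  carrier : Type ;
  dist : carrier -> carrier -> {nonneg R} }.

Definition pseudoultrametric (R : realType) (X : Type)
    (d : X -> X -> {nonneg R}) : Prop :=
  [/\ forall x, d x x = 0%:nng,
      forall x y, d x y = d y x &
      forall x y z, d x y <= Num.max (d x z) (d z y)].

(* Classes of spaces are plain predicates rather than [set (distSpace R)]:
   the latter would force every carrier into a universe strictly below that of
   [{nonneg R}], so [{nonneg R}] itself could not carry a [distSpace]. For the
   same reason nonemptiness of a carrier is [inhabited] rather than [!=set0]. *)
Definition spaceClass (R : realType) := distSpace R -> Prop.

Definition PU (R : realType) : spaceClass R :=
  fun S => inhabited (carrier S) /\ pseudoultrametric (@dist R S).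

Definition postcomp (R : realType) (f : {nonneg R} -> {nonneg R})
    (S : distSpace R) : distSpace R :=
  DistSpace (fun x y => f (dist (d := S) x y)).

Definition preserving (R : realType) (X : spaceClass R) :
    set ({nonneg R} -> {nonneg R}) :=
  [set f | forall S, X S -> X (postcomp f S)].

Definition pseudoultrametric_preserving (R : realType) :
    set ({nonneg R} -> {nonneg R}) :=
  [set f | forall (X : Type) (d : X -> X -> {nonneg R}),
     inhabited X -> pseudoultrametric d ->
     pseudoultrametric (fun x y => f (d x y))].

Definition max_endomorphism (R : realType) :
    set ({nonneg R} -> {nonneg R}) :=
  [set f | (forall x y : {nonneg R}, f (Num.max x y) = Num.max (f x) (f y)) /\
           f 0%:nng = 0%:nng].

(* [A] is a submonoid of the monoid [M] of self-maps of [T] under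
   composition. *)
Definition submonoid (T : Type) (M A : set (T -> T)) : Prop :=
  [/\ A !=set0, A `<=` M, A id & forall f g, A f -> A g -> A (f \o g)].

(* [M] is itself a monoid under composition exactly when it is a submonoid of
   the monoid [setT] of all self-maps. *)
Lemma pseudoultrametric_preserving_monoid (R : realType) :
  submonoid setT (@pseudoultrametric_preserving R).
Proof.
have PUid : pseudoultrametric_preserving (R := R) id by [].
split=> //; first by exists id.
by move=> f g Pf Pg X d X0 /(Pg X d X0)/(Pf X _ X0).
Qed.

Lemma max_endomorphism_monoid (R : realType) :
  submonoid setT (@max_endomorphism R).
Proof.
have Eid : max_endomorphism (R := R) id by [].
split=> //; first by exists id.
move=> f g [fM f0] [gM g0]; split=> [x y|] /=; first by rewrite gM fM.
by rewrite g0 f0.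
Qed.

Lemma preserving_PU (R : realType) :
  preserving (@PU R) = @pseudoultrametric_preserving R.
Proof.
apply/seteqP; split=> [f fPU X d X0 dPU | f fP [X d] [X0 dPU]].
  by have [] := fPU (DistSpace d) (conj X0 dPU).
by split=> //; exact: fP.
Qed.

(* Main.v *)
(** The max metric on [0, +oo[, d(x, y) = max(x, y) for x <> y, is an
    ultrametric that does all the work.  Since f o d is a pseudoultrametric for
    a pseudoultrametric-preserving f, the triangle with vertices 0 < x < y gives
    f x <= f y, and monotone maps commute with max.  Conversely, since
    d(0, x) = x, the function f can be read off from f o d; hence, for a
    submonoid A, the class of all ([0, +oo[, f o d) with f in A is preserved
    exactly by the elements of A. *)

Require Import Defs.
From HB Require Import structures.
From mathcomp Require Import all_boot all_order all_algebra.
From mathcomp Require Import all_classical all_reals interval_inference.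

Import Order.TTheory GRing.Theory Num.Theory.

Local Open Scope classical_set_scope.
Local Open Scope ring_scope.

(* As a tactic argument, [0%:nng] would elaborate to a function of its interval
   side condition. *)
Definition nng0 {R : realType} : {nonneg R} := 0%:nng.

Lemma nng0_le {R : realType} (x : {nonneg R}) : (nng0 <= x)%R.
Proof. by change (0 <= x%:num); exact: ge0. Qed.

Definition max_dist {R : realType} (x y : {nonneg R}) : {nonneg R} :=
  if x == y then nng0 else Num.max x y.

Lemma max_dist_pseudoultrametric (R : realType) :
  pseudoultrametric (@max_dist R).
Proof.
split=> [x|x y|x y z]; rewrite /max_dist; first by rewrite eqxx.
  by rewrite eq_sym maxC.
have [_|xy] := eqVneq x y; first exact: nng0_le.
have [<-|_] := eqVneq x z.
  by rewrite (negPf xy) le_max lexx orbT.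
have [->|_] := eqVneq z y; first by rewrite le_max lexx.
by rewrite ge_max !le_max !lexx /= !orbT.
Qed.

Lemma max_dist0 {R : realType} (x : {nonneg R}) : max_dist nng0 x = x.
Proof.
by rewrite /max_dist; case: eqP => [//|_]; exact/max_idPr/nng0_le.
Qed.

Lemma max_dist_lt {R : realType} {x y : {nonneg R}} :
  (x < y)%R -> max_dist y x = y.
Proof. by move=> xy; rewrite /max_dist gt_eqF//; exact/max_idPl/ltW. Qed.

Lemma pseudoultrametric_preserving_sub_endomorphism {R : realType} :
  @pseudoultrametric_preserving R `<=` @max_endomorphism R.
Proof.
move=> f fP.
have [f0 _ ft] := fP _ _ (inhabits nng0) (max_dist_pseudoultrametric R).
have f00 : f nng0 = nng0 by rewrite -{1}(max_dist0 nng0) f0.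
have f_homo x y : (x <= y)%R -> (f x <= f y)%R.
  rewrite le_eqVlt => /predU1P[->//|xy].
  (* Both sides at the vertex [y] have length [y], so the bound collapses to [f y]. *)
  by have := ft nng0 x y; rewrite !max_dist0 (max_dist_lt xy) maxxx.
split=> // x y; have [xy|/ltW yx] := leP x y.
  by rewrite (max_idPr (f_homo _ _ xy)).
by rewrite (max_idPl (f_homo _ _ yx)).
Qed.

(** The distances agree up to a cast along a proof of [T = T], which proof irrelevance turns into
    [erefl]. *)
Lemma DistSpace_inj {R : realType} {T : Type} {d d' : T -> T -> {nonneg R}} :
  DistSpace d = DistSpace d' -> d = d'.
Proof.
have castE (S S' : distSpace R) (E : S = S') :
    dist (d := S) = fun x y =>
      let c := fun u => ecast Z Z (congr1 (@carrier R) E) u in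
      dist (d := S') (c x) (c y) by case: _ / E.
move=> E; apply: etrans (castE _ _ E) _.
by rewrite (Prop_irrelevance (congr1 (@carrier R) E) erefl).
Qed.

Lemma preserving_submonoid {R : realType} (X : spaceClass R) :
  submonoid setT (preserving X).
Proof.
(* [postcomp id S] is convertible to [S] only once [S] is destructed. *)
have Xid : preserving X id by move=> [].
split=> //; first by exists id.
by move=> f g Xf Xg S /Xg/Xf.
Qed.

(** As [id] is in [A], the class contains the max metric itself, whose image under [f] must then be
    some [g \o d] with [g] in [A]; evaluation at [(0, x)] gives [f = g]. Closure under composition
    gives the converse. *)
Lemma submonoid_preserving_orbit {R : realType}
    (A : set ({nonneg R} -> {nonneg R})) :
  submonoid setT A ->
  preserving (fun S => exists2 f, A f & S = postcomp f (DistSpace (@max_dist R)))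
    = A.
Proof.
move=> [_ _ Aid Acomp]; apply/seteqP; split=> [f fX | f Af _ [g Ag ->]].
  have [|g Ag /DistSpace_inj E] := fX (DistSpace (@max_dist R)).
    by exists id.
  suff -> : f = g by [].
  by apply/funext => x; have := congr1 (fun d => d nng0 x) E; rewrite /= !max_dist0.
by exists (f \o g) => //; exact: Acomp.
Qed.

Theorem theorem3p6 (R : realType) (A : set ({nonneg R} -> {nonneg R}))
    (A_neq0 : A !=set0) (A_sub : A `<=` @pseudoultrametric_preserving R) :
  [<-> submonoid (@pseudoultrametric_preserving R) A;
       submonoid (@max_endomorphism R) A;
       exists X : spaceClass R,
         [/\ exists S, X S, forall S, X S -> PU S & preserving X = A]].
Proof.
tfae.
- move=> [_ _ Aid Acomp]; split=> //.
  exact: subset_trans A_sub (@pseudoultrametric_preserving_sub_endomorphism R).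
- move=> [_ _ Aid Acomp].
  exists (fun S => exists2 f, A f & S = postcomp f (DistSpace (@max_dist R))).
  split; last exact: submonoid_preserving_orbit.
    by exists (DistSpace (@max_dist R)), id.
  move=> _ [f Af ->]; split; first exact: (inhabits nng0).
  exact: A_sub Af _ _ (inhabits nng0) (max_dist_pseudoultrametric R).
- move=> [X [_ _ XA]]; rewrite -XA in A_neq0 A_sub *.
  by have [_ _ Xid Xcomp] := preserving_submonoid X; split.
Qed.
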